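(* Let $(G,d)$ be a $p$-uniformly convex metric space and let $f:G\to\mathbb{R}$. Let $(x^k)_{k\in\mathbb{N}}$ be a sequence generated by the basic descent algorithm. Assume: (a) the sequence $(x^k)_{k\in\mathbb{N}}$ is contained in $U$, a convex subset of $G$, and $f$ possesses at least one local minimum $x^*$ on $U$; (b) the sequence satisfies the sufficient decrease condition: there exists $\delta>0$ such that $$f(x^{k+1})-f(x^k)\leq-\frac1\delta\,|D|f(x^k)^{\frac{2}{p-1}}\qquad\text{for all }k\in\mathbb{N};$$ (c) $f$ satisfies the Polyak–Łojasiewicz property at $x^*$ with constant $C\in(0,\delta)$ on $U$, i.e. $|D|f(x)^{\frac{2}{p-1}}\geq C\,(f(x)-f(x^* ))$ for all $x\in U$. Then $(f(x^k))_{k\in\mathbb{N}}$ converges at least linearly to the local minimum $f_*:=f(x^* )$, with $$f(x^k)-f_*\leq\bigl(f(x^0)-f_*\bigr)\Bigl(1-\tfrac C\delta\Bigr)^k\qquad\text{for all }k\in\mathbb{N}.$$ If, in addition to the assumptions above, $(G,d)$ is complete and (d) $f$ has local uniform Lipschitz gradient along geodesics with constant $L>0$ on $U$, and (e) the sequence is stable, i.e. $d(x^{k+1},x^k)\leq\frac{1}{\sqrt\delta}|D|f(x^k)^{\frac1{p-1}}$ for all $k\in\mathbb{N}$, then the sequence $(x^k)$ converges at least linearly to a local minimizer $\bar x\in\mathrm{argmin}_U(f)$, with $$d(x^k,\bar x)\leq\frac{\sqrt{f(x^0)-f_*}}{1-\sqrt{1-\tfrac C\delta}}\Bigl(\sqrt{1-\tfrac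 C\delta}\Bigr)^k\qquad\text{for all }k.$$
   Context: Spaces. A metric space $(G,d)$ is uniquely geodesic if for all $x_0,x_1\in G$ there is a unique path $\gamma=\gamma_{[x_0,x_1]}:[0,1]\to G$ with $\gamma(0)=x_0$, $\gamma(1)=x_1$ and $d(\gamma(t),\gamma(s))=|t-s|\,d(x_0,x_1)$ for all $s,t\in[0,1]$; write $(1-t)x_0\oplus t x_1:=\gamma(t)$. It is $p$-uniformly convex ($p>1$, constant $c>0$) if it is uniquely geodesic and for all $x_0,x_1,y\in G$, $t\in[0,1]$, with $x_t=(1-t)x_0\oplus tx_1$: $d(x_t,y)^p\leq(1-t)d(x_0,y)^p+t\,d(x_1,y)^p-\frac c2 t(1-t)d(x_0,x_1)^p$. For $x\in G$, $G_x:=\{\gamma_{[x,y]}\mid y\in G\}$ with metric $d_x(\gamma_1,\gamma_2):=d(\gamma_1(1),\gamma_2(1))$, and $G_x^\circ:=G_x\setminus\{\gamma_{[x,x]}\}$. A set $U\subset G$ is convex if it contains $\gamma_{[x,y]}(t)$ for all $x,y\in U$, $t\in[0,1]$. Local minimum: throughout the paper the reference point $x^*$ in the Polyak–Łojasiewicz property is a local minimum in the sense that $x^*\in\mathrm{argmin}_U(f)$, where $U$ is a convex set containing $x^*$ in its interior. Derivatives. For $\gamma\in G_x$: $S^-f(x)[\gamma]:=\liminf_{t\searrow0}\frac{f(\gamma(t))-f(x)}{t}$, $S^+f(x)[\gamma]:=\limsup_{t\searrow0}\frac{f(\gamma(t))-f(x)}{t}$, $d^-f(x)[\gamma]:=\liminf_{\eta\to\gamma}S^-f(x)[\eta]$,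 $d^+f(x)[\gamma]:=\limsup_{\eta\to\gamma}S^+f(x)[\eta]$, where $\eta\to\gamma$ in $(G_x,d_x)$ and $\eta=\gamma$ is allowed. For $\gamma\in G_x^\circ$, $D^\pm f(x)[\gamma]:=d^\pm f(x)[\gamma]/d(\gamma(0),\gamma(1))$. $f$ is directionally differentiable at $x$ in direction $\gamma$ if $d^+f(x)[\gamma]=d^-f(x)[\gamma]=df(x)[\gamma]:=\lim_{t\searrow0}\frac{f(\gamma(t))-f(x)}{t}\in\mathbb{R}$; then $Df(x)[\gamma]:=df(x)[\gamma]/d(\gamma(0),\gamma(1))$ for $\gamma\in G_x^\circ$. The steepness of $f$ at $x$ is $|D|f(x):=\sup_{\gamma\in G_x^\circ}|D^+f(x)[\gamma]|\in[0,+\infty]$. Lipschitz gradient. For convex $U$, $C^1(U)$ is the set of continuous $f$ on $U$ such that $t\mapsto f(\gamma_{[x,y]}(t))$ is $C^1$ on $[0,1]$ for all distinct $x,y\in U$. $f$ has local uniform Lipschitz gradient along geodesics with constant $L$ on $U$ if $f\in C^1(U)$ and for all (distinct) $x,y\in U$, all $t,s\in[0,1)$, with $x_t=\gamma_{[x,y]}(t)$, $x_s=\gamma_{[x,y]}(s)$: $|Df(x_t)[\gamma_{[x_t,y]}]-Df(x_s)[\gamma_{[x_s,y]}]|\le L\,d(x_t,x_s)$. Basic descent algorithm. Choose $x^0\in G$, $k=0$. Let $\mathcal D_k:=\{y\in G\setminus\{x^k\}\mid D^-f(x^k)[\gamma_{[x^k,y]}]<0\}$. While $\mathcal D_k\ne\emptyset$: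 choose a descent step $y^k\in\mathcal D_k$ and step scaling $\lambda_k\in(0,1]$, set $x^{k+1}=(1-\lambda_k)x^k\oplus\lambda_ky^k$ and increase $k$ by one.
   Formalization: Since U is only assumed convex, the limit of the iterates may lie outside U; the claim that the limit belongs to argmin_U(f) is therefore made only when U is closed or the limit lies in U. *)

(* Defs.v *)
From HB Require Import structures.
From mathcomp Require Import all_boot all_order all_algebra.
From mathcomp Require Import all_classical all_reals all_analysis.

Set Implicit Arguments.
Unset Strict Implicit.
Unset Printing Implicit Defensive.
Import Order.TTheory GRing.Theory Num.Theory.
Import numFieldNormedType.Exports.
Local Open Scope classical_set_scope.
Local Open Scope ring_scope.

(* A path [0, 1] -> G is encoded as a function R -> G of which only the values
   on `[0, 1] are meaningful; this is why uniqueness of geodesics is stated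
   up to equality on `[0, 1]. *)
Definition is_geodesic (R : realType) (G : metricType R) (x0 x1 : G)
    (g : R -> G) : Prop :=
  [/\ g 0 = x0, g 1 = x1 &
      forall t s : R, t \in `[0, 1] -> s \in `[0, 1] ->
        mdist (g t) (g s) = `|t - s| * mdist x0 x1].

Definition uniquely_geodesic (R : realType) (G : metricType R) : Prop :=
  forall x0 x1 : G, exists g : R -> G, is_geodesic x0 x1 g /\
    forall h : R -> G, is_geodesic x0 x1 h -> {in `[0, 1], h =1 g}.

(* gamma_[x0, x1]; the point (1 - t) x0 (+) t x1 is [geod x0 x1 t].  The default
   value is only used when there is no geodesic from x0 to x1. *)
Definition geod (R : realType) (G : metricType R) (x0 x1 : G) : R -> G :=
  xget (fun _ : R => x0) [set g | is_geodesic x0 x1 g].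

Definition uniformly_convex (R : realType) (G : metricType R) (p c : R) : Prop :=
  [/\ 1 < p, 0 < c, uniquely_geodesic G &
      forall (x0 x1 y : G) (t : R), t \in `[0, 1] ->
        mdist (geod x0 x1 t) y `^ p <=
          (1 - t) * mdist x0 y `^ p + t * mdist x1 y `^ p
          - c / 2 * t * (1 - t) * mdist x0 x1 `^ p].

Definition geod_convex (R : realType) (G : metricType R) (U : set G) : Prop :=
  forall (x y : G) (t : R), U x -> U y -> t \in `[0, 1] -> U (geod x y t).

Definition complete_space (R : realType) (G : metricType R) : Prop :=
  forall F : set_system G, ProperFilter F -> cauchy F -> exists l : G, F --> l.

Definition Gdir (R : realType) (G : metricType R) (x : G) : set (R -> G) :=
  [set geod x y | y in [set: G]].

Definition Gdir0 (R : realType) (G : metricType R) (x : G) : set (R -> G) :=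
  Gdir x `\ geod x x.

Definition Gdir_dist (R : realType) (G : metricType R) (g1 g2 : R -> G) : R :=
  mdist (g1 1) (g2 1).

(* The neighbourhoods of g in the metric space (Gdir x, Gdir_dist); g itself
   is not removed. *)
Definition Gdir_nbhs (R : realType) (G : metricType R) (x : G) (g : R -> G) :
    set_system (R -> G) :=
  filter_from [set e : R | 0 < e]
    (fun e => [set h | Gdir x h /\ Gdir_dist g h < e]).

(* limf_esup and limf_einf require a filtered type, which R -> G is not. *)
Definition Gpath (R : realType) (G : metricType R) (x : G) : Type := R -> G.

HB.instance Definition _ (R : realType) (G : metricType R) (x : G) :=
  Choice.copy (Gpath x) (R -> G).

HB.instance Definition _ (R : realType) (G : metricType R) (x : G) :=
  isFiltered.Build (R -> G) (Gpath x) (Gdir_nbhs x).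

Section derivatives.
Context {R : realType} {G : metricType R}.
Implicit Types (f : G -> R) (x : G) (g : R -> G).

Definition diff_quotient f x g (t : R) : R := (f (g t) - f x) / t.

Definition Sminus f x g : \bar R :=
  limf_einf (fun t => (diff_quotient f x g t)%:E) 0^'+.

Definition Splus f x g : \bar R :=
  limf_esup (fun t => (diff_quotient f x g t)%:E) 0^'+.

Definition dminus f x g : \bar R :=
  limf_einf (fun h : Gpath x => Sminus f x h) (nbhs (g : Gpath x)).

Definition dplus f x g : \bar R :=
  limf_esup (fun h : Gpath x => Splus f x h) (nbhs (g : Gpath x)).

Definition Dminus f x g : \bar R :=
  (dminus f x g * ((mdist (g 0) (g 1))^-1)%:E)%E.

Definition Dplus f x g : \bar R :=
  (dplus f x g * ((mdist (g 0) (g 1))^-1)%:E)%E.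

Definition dir_differentiable f x g : Prop :=
  exists l : R, [/\ dplus f x g = l%:E, dminus f x g = l%:E &
                    diff_quotient f x g t @[t --> 0^'+] --> l].

Definition ddir f x g : R := lim (diff_quotient f x g t @[t --> 0^'+]).

Definition Ddir f x g : R := ddir f x g / mdist (g 0) (g 1).

(* The supremum is taken in [0, +oo]: adding 0 only matters when [Gdir0 x] is
   empty, since [ereal_sup set0] is -oo. *)
Definition steepness f x : \bar R :=
  ereal_sup (0%E |` [set (`|Dplus f x g|)%E | g in Gdir0 x]).

End derivatives.

(* Derivatives at 0 and 1 are one-sided, limits being taken within `[0, 1]. *)
Definition C1_unit_interval (R : realType) (h : R -> R) : Prop :=
  exists2 h' : R -> R, {within `[0, 1], continuous h'} &
    forall t : R, t \in `[0, 1] ->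
      (h s - h t) / (s - t) @[s --> within `[0, 1] t^'] --> h' t.

Definition C1_on (R : realType) (G : metricType R) (U : set G) (f : G -> R) :
    Prop :=
  {within U, continuous f} /\
  forall x y : G, U x -> U y -> x != y ->
    C1_unit_interval (fun t => f (geod x y t)).

(* The derivatives D f (x_t) [gamma_[x_t, y]] are only defined when f is
   directionally differentiable at x_t in that direction, so that their
   appearance in the inequality presupposes it. *)
Definition lipschitz_gradient (R : realType) (G : metricType R) (U : set G)
    (L : R) (f : G -> R) : Prop :=
  [/\ C1_on U f,
      (forall (x y : G) (t : R), U x -> U y -> x != y -> t \in `[0, 1[ ->
        dir_differentiable f (geod x y t) (geod (geod x y t) y)) &
      forall (x y : G) (t s : R), U x -> U y -> x != y ->
        t \in `[0, 1[ -> s \in `[0, 1[ ->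
        let xt := geod x y t in
        let xs := geod x y s in
        `|Ddir f xt (geod xt y) - Ddir f xs (geod xs y)| <= L * mdist xt xs].

Definition argmin (R : realType) (G : metricType R) (U : set G) (f : G -> R) :
    set G :=
  [set z | U z /\ forall y, U y -> f z <= f y].

Definition local_minimum (R : realType) (G : metricType R) (U : set G)
    (f : G -> R) (z : G) : Prop :=
  [/\ geod_convex U, interior U z & argmin U f z].

Definition descent_set (R : realType) (G : metricType R) (f : G -> R) (x : G) :
    set G :=
  [set y | y != x /\ (Dminus f x (geod x y) < 0)%E].

(* An infinite run of the algorithm: the sets of descent directions are
   nonempty at all iterates. *)
Definition basic_descent (R : realType) (G : metricType R) (f : G -> R)
    (x : nat -> G) : Prop :=
  forall k : nat, exists (y : G) (lambda : R),
    [/\ descent_set f (x k) y, 0 < lambda, lambda <= 1 &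
        x k.+1 = geod (x k) y lambda].

Definition sufficient_decrease (R : realType) (G : metricType R) (p delta : R)
    (f : G -> R) (x : nat -> G) : Prop :=
  forall k : nat,
    ((f (x k.+1) - f (x k))%:E <=
       - ((delta^-1)%:E * steepness f (x k) `^ (2 / (p - 1))))%E.

Definition polyak_lojasiewicz (R : realType) (G : metricType R) (p C : R)
    (U : set G) (f : G -> R) (z : G) : Prop :=
  forall x : G, U x ->
    ((C * (f x - f z))%:E <= steepness f x `^ (2 / (p - 1)))%E.

Definition stable_seq (R : realType) (G : metricType R) (p delta : R)
    (f : G -> R) (x : nat -> G) : Prop :=
  forall k : nat,
    ((mdist (x k.+1) (x k))%:E <=
       ((Num.sqrt delta)^-1)%:E * steepness f (x k) `^ (1 / (p - 1)))%E.

(* Main.v *)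
(* With E k := f (x k) - f xstar, sufficient decrease and the
   Polyak-Lojasiewicz inequality give E (k+1) <= (1 - C / delta) E k.
   Sufficient decrease also bounds the squared right-hand side of the stability
   condition by f (x k) - f (x (k+1)) <= E k, so the steps are dominated by a
   geometric sequence of ratio sqrt (1 - C / delta) and the iterates form a
   Cauchy sequence.  By continuity of f on U their limit attains the minimum. *)
Require Import Defs.
From HB Require Import structures.
From mathcomp Require Import all_boot all_order all_algebra.
From mathcomp Require Import all_classical all_reals all_analysis.
From mathcomp Require Import ring lra.

Set Implicit Arguments.
Unset Strict Implicit.
Unset Printing Implicit Defensive.
Import Order.TTheory GRing.Theory Num.Theory.
Import numFieldNormedType.Exports.
Local Open Scope classical_set_scope.
Local Open Scope ring_scope.

Lemma mdist_geometric_steps (R : realType) (G : metricType R) (u : nat -> G)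
    (a r : R) :
  0 <= r -> r < 1 ->
  (forall k, mdist (u k.+1) (u k) <= a * r ^+ k) ->
  forall k n, mdist (u k) (u (k + n)%N) <= a / (1 - r) * r ^+ k.
Proof.
move=> r0 r1 step k n.
have a0 : 0 <= a.
  by have := le_trans (mdist_ge0 _ _) (step 0%N); rewrite expr0 mulr1.
have q0 : 0 < 1 - r by rewrite subr_gt0.
(* Keeping the subtracted term [r ^+ (k + n)] makes the induction close: adding the step
   [a * r ^+ (k + n)] turns the bound for [n] into exactly the bound for [n.+1]. *)
suff : mdist (u k) (u (k + n)%N) <= a / (1 - r) * (r ^+ k - r ^+ (k + n)).
  move=> /le_trans; apply; rewrite ler_wpM2l ?divr_ge0 ?(ltW q0)//.
  by rewrite lerBlDr lerDl exprn_ge0.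
elim: n => [|n IHn]; first by rewrite addn0 subrr mulr0 mdistxx.
rewrite (le_trans (metric_triangle _ (u (k + n)%N) _))//.
rewrite addnS (metric_sym (u (k + n)%N)).
rewrite (le_trans (lerD IHn (step _)))// exprS.
by rewrite le_eqVlt; apply/orP; left; apply/eqP; field; rewrite gt_eqF.
Qed.

Lemma cvg_geometric_steps (R : realType) (G : metricType R) (u : nat -> G)
    (a r : R) :
  complete_space G -> 0 <= r -> r < 1 ->
  (forall k, mdist (u k.+1) (u k) <= a * r ^+ k) ->
  exists2 l : G, u k @[k --> \oo] --> l &
    forall k, mdist (u k) l <= a / (1 - r) * r ^+ k.
Proof.
move=> complG r0 r1 step.
have dist := mdist_geometric_steps r0 r1 step.
have [|l ul] := complG (u @ \oo) _.
  (* A ball of radius [e] around [u N] contains the whole tail from [N] on, once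
     [a / (1 - r) * r ^+ N < e]. *)
  apply: cauchy_exP => e e0.
  have rN : `|r| < 1 by rewrite ger0_norm.
  have /cvgr_lt/(_ _ e0)[N _ NP] := cvg_geometric (a / (1 - r)) rN.
  exists (u N); exists N => // n /= Nn.
  rewrite ballEmdist/= -(subnKC Nn).
  exact: le_lt_trans (dist _ _) (NP N (leqnn N)).
(* The bound is uniform in the offset, so it passes to the limit; taking the threshold [N] as offset
   from [k] ensures [k + N >= N]. *)
exists l => // k; apply/ler_addgt0Pr => e e0.
have [N _ NP] := metricType_numDomainType.cvgr_dist_le ul e0.
rewrite (le_trans (metric_triangle _ (u (k + N)%N) _))//.
by rewrite lerD ?dist// metric_sym; apply: NP; exact: leq_addl.
Qed.

(** An infinite power of the steepness would force the real decrease [f (x k.+1) - f (x k)] below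
    -oo. A single real [b] serves both exponents because [2 / (p - 1)] is twice [1 / (p - 1)]. *)
Lemma sufficient_decrease_fin (R : realType) (G : metricType R) (p delta : R)
    (f : G -> R) (x : nat -> G) :
  0 < delta -> sufficient_decrease p delta f x ->
  forall k, exists b : R,
    [/\ 0 <= b, (steepness f (x k) `^ (1 / (p - 1)) = b%:E)%E,
        (steepness f (x k) `^ (2 / (p - 1)) = (b ^+ 2)%:E)%E &
        f (x k.+1) - f (x k) <= - (delta^-1 * b ^+ 2)].
Proof.
move=> delta0 decr k; move: (decr k).
have -> : 2 / (p - 1) = 1 / (p - 1) * 2 by rewrite mul1r mulrC.
rewrite poweRrM.
have := poweR_ge0 (steepness f (x k)) (1 / (p - 1)).
case: (_ `^ _)%E => [b||//].
  rewrite lee_fin => b0; rewrite poweR_EFin powR_mulrn// => decrk.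
  by exists b; split => //; move: decrk; rewrite -EFinM -EFinN lee_fin.
by move=> _; rewrite poweRyr// gt0_muley ?lte_fin ?invr_gt0.
Qed.

(** Continuity within [U] controls [f] only at points of [U] near [l], which suffices as the
    sequence never leaves [U]. *)
Lemma within_continuous_lim (R : realType) (G : metricType R) (U : set G)
    (f : G -> R) (u : nat -> G) (l : G) :
  {within U, continuous f} -> (forall k, U (u k)) -> U l ->
  u k @[k --> \oo] --> l -> f (u k) @[k --> \oo] --> f l.
Proof.
move=> /subspace_continuousP fU Uu Ul ul; apply: cvg_trans (fU _ Ul).
move=> A /= fA; have [N _ NP] := ul _ fA.
by exists N => // n Nn; apply: NP.
Qed.

(* U is not assumed closed, so the limit xbar may fall outside U, where f is
   unconstrained; membership in argmin_U f is claimed when U is closed, and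
   more generally whenever xbar belongs to U. *)
Theorem theorem1p2 (R : realType) (G : metricType R) (p c : R) (f : G -> R)
    (x : nat -> G) (U : set G) (xstar : G) (delta C : R) :
  uniformly_convex G p c ->
  basic_descent f x ->
  geod_convex U ->
  (forall k, U (x k)) ->
  local_minimum U f xstar ->
  0 < delta ->
  sufficient_decrease p delta f x ->
  0 < C -> C < delta ->
  polyak_lojasiewicz p C U f xstar ->
  (f (x k) @[k --> \oo] --> f xstar /\
   forall k, f (x k) - f xstar <=
     (f (x 0%N) - f xstar) * (1 - C / delta) ^+ k) /\
  (complete_space G ->
   forall L : R, 0 < L ->
   lipschitz_gradient U L f ->
   stable_seq p delta f x ->
   exists xbar : G,
     [/\ x k @[k --> \oo] --> xbar,
         closed U \/ U xbar -> argmin U f xbar &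
         forall k, mdist (x k) xbar <=
           Num.sqrt (f (x 0%N) - f xstar) / (1 - Num.sqrt (1 - C / delta))
           * Num.sqrt (1 - C / delta) ^+ k]).
Proof.
move=> _ _ _ Ux [_ _ [_ xmin]] delta0 decr C0 Cdelta PL.
have b_ := sufficient_decrease_fin delta0 decr.
have Cd0 : 0 < C / delta by rewrite divr_gt0.
have Cd1 : C / delta < 1 by rewrite ltr_pdivrMr ?mul1r.
have q0 : 0 <= 1 - C / delta by rewrite subr_ge0 ltW.
have q1 : 1 - C / delta < 1 by rewrite ltrBlDr ltrDl.
have E0 k : 0 <= f (x k) - f xstar by rewrite subr_ge0 xmin.
have rate k : f (x k) - f xstar <=
    (f (x 0%N) - f xstar) * (1 - C / delta) ^+ k.
  elim: k => [|k IHk]; first by rewrite expr0 mulr1.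
  have [b [_ _ b2 decrk]] := b_ k.
  have := PL _ (Ux k); rewrite b2 lee_fin => PLk.
  rewrite exprSr mulrA; apply: le_trans (ler_wpM2r q0 IHk).
  have : delta^-1 * (C * (f (x k) - f xstar)) <= delta^-1 * b ^+ 2.
    by rewrite ler_wpM2l// invr_ge0 ltW.
  have -> : (f (x k) - f xstar) * (1 - C / delta) =
      (f (x k) - f xstar) - delta^-1 * (C * (f (x k) - f xstar)) by ring.
  by lra.
have fcvg : f (x k) @[k --> \oo] --> f xstar.
  have qN : `|1 - C / delta| < 1 by rewrite ger0_norm.
  rewrite -[f xstar]add0r; under eq_fun do rewrite -(subrK (f xstar) (f (x _))).
  apply: cvgD; last exact: cvg_cst.
  apply: (squeeze_cvgr _ (cvg_cst 0) (cvg_geometric (f (x 0%N) - f xstar) qN)).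
  by apply: nearW => k; rewrite E0 rate.
split=> // complG L _ [[fU _] _ _] stab.
have r1 : Num.sqrt (1 - C / delta) < 1 by rewrite -[ltRHS]sqrtr1 ltr_sqrt.
have step k : mdist (x k.+1) (x k) <=
    Num.sqrt (f (x 0%N) - f xstar) * Num.sqrt (1 - C / delta) ^+ k.
  have [b [b0 b1 _ decrk]] := b_ k.
  have := stab k; rewrite b1 -EFinM lee_fin => /le_trans; apply.
  (* Both sides are nonnegative, so squares are compared: the left one is [delta^-1 * b ^+ 2], the
     right one is the bound of [rate k]. *)
  rewrite -ler_sqr ?nnegrE ?mulr_ge0 ?invr_ge0 ?exprn_ge0 ?sqrtr_ge0//.
  rewrite !exprMn exprVn exprAC !sqr_sqrtr ?(ltW delta0)//.
  apply: le_trans (rate k).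
  by have := E0 k.+1; lra.
have [xbar xcvg dist] := cvg_geometric_steps complG (sqrtr_ge0 _) r1 step.
exists xbar; split => // UxbarP.
have Uxbar : U xbar.
  case: UxbarP => // clU.
  by apply: (closed_cvg _ clU _ _ xcvg); exact: nearW.
(* The values [f (x k)] tend both to [f xstar], by the linear rate, and to [f xbar], by
   continuity. *)
have fxbar : f xbar = f xstar.
  apply: (@cvg_unique _ _ (f (x k) @[k --> \oo])) => //.
  exact: within_continuous_lim fU Ux Uxbar xcvg.
by split=> // y Uy; rewrite fxbar xmin.
Qed.
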